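(* Let $\psi=\sum_{k=1}^{\infty}R_{\ell+k}(\ln x)x^k$ be the formal power-log series solution, described in the context, of the reduced equation $$L(\delta)u=x\,M(x,\ln x,u,\delta u,\ldots,\delta^n u),\qquad L(\delta)=\sum_{j=0}^n a_j(\ln x)(\delta+\ell)^j .$$ There is a finite set $\Delta=\{t_1,\ldots,t_s\}\subset\mathbb{C}$, common for all $k\geqslant 1$, such that the rational functions $R_{\ell+k}(t)$ can only have poles at points of $\Delta$ and maybe at infinity. For the order $\mathrm{ord}_{t_0}R_{\ell+k}(t)$ at each point $t_0\in\Delta$ there holds the estimate $$-\mathrm{ord}_{t_0}R_{\ell+k}(t)\leqslant k\,C,\qquad k\geqslant 1,$$ where $C>0$ is a constant that depends on the equation only (in particular, not on $k$).
   Context: Here $\delta=x\,\frac{d}{dx}$. A power-log series is a formal series $\sum_{k\geqslant0}R_k(\ln x)x^k$ with $R_k\in\mathbb{C}(t)$. Such series are added and multiplied formally as power series in $x$ with coefficients in $\mathbb{C}(\ln x)$, and $\delta$ acts termwise by $\delta\bigl(R_k(\ln x)x^k\bigr)=x^k\bigl(kR_k+R_k'\bigr)(\ln x)$. Setting. Let $F(x,y_0,\ldots,y_n)$ be a polynomial with complex coefficients and let $\varphi=\sum_{k=0}^{\infty}R_k(\ln x)x^k$, $R_k\in\mathbb{C}(t)$, be a power-log series with $F(x,\Phi)=0$, $\Phi=(\varphi,\delta\varphi,\ldots,\delta^n\varphi)$. Assume that for each $j=0,\ldots,n$ one has $\frac{\partial F}{\partial y_j}(x,\Phi)=a_j(\ln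 x)x^m+a_j^1(\ln x)x^{m+1}+\ldots$ with $a_j,a_j^1,\ldots\in\mathbb{C}(t)$, the integer $m\geqslant0$ being the same for all $j$, and $a_n\not\equiv0$. Let $\ell>m$ be an integer. Substituting $y=\sum_{k=0}^{\ell}R_k(\ln x)x^k+x^{\ell}u$ into $F(x,y,\delta y,\ldots,\delta^ny)=0$ and dividing by $x^{m+\ell}$ gives an equation of the form $L(\delta)u=x\,M(x,\ln x,u,\delta u,\ldots,\delta^nu)$ with $L(\delta)=\sum_{j=0}^na_j(\ln x)(\delta+\ell)^j$ and with $M$ rational in $\ln x$ and polynomial in the other $n+2$ variables. This reduced equation has the formal solution $\psi=\sum_{k\geqslant1}R_{\ell+k}(\ln x)x^k$. $\mathrm{ord}_{t_0}R$ denotes the order of the rational function $R$ at $t_0$: it is positive at zeros, minus the pole order at poles, and $+\infty$ for $R\equiv0$. *)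

(* Defs.v *)
(* The notations of mpoly clash with those of the reals
   library, so the one that is needed is redeclared here. *)
From HB Require Import structures.
From mathcomp Require Import all_boot all_order all_algebra.
From mathcomp Require Import complex boolp reals constructive_ereal.
From mathcomp Require Import -(notations) mpoly.

Set Implicit Arguments.
Unset Strict Implicit.
Unset Printing Implicit Defensive.

Import Order.TTheory GRing.Theory Num.Theory.
Local Open Scope ring_scope.

Notation "{ 'mpoly' T [ n ] }" := (mpoly n T)
  (at level 0, T, n at level 2, format "{ 'mpoly'  T [ n ] }") : type_scope.

(* Formal power series over A, as coefficient sequences.  The carrier is an
   alias of nat -> A so as to carry the Cauchy product, not the pointwise one. *)
Definition fps (A : Type) := nat -> A.

HB.instance Definition _ (A : Type) := gen_eqMixin (fps A).
HB.instance Definition _ (A : Type) := gen_choiceMixin (fps A).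

Section FpsRing.
Variable A : comNzRingType.
Implicit Types f g h : fps A.

Definition fpsC (c : A) : fps A := fun k => if k == 0%N then c else 0.
Definition fpsX : fps A := fun k => (k == 1%N)%:R.

Definition fps_add f g : fps A := fun k => f k + g k.
Definition fps_opp f : fps A := fun k => - f k.
Definition fps_mul f g : fps A := fun k => \sum_(i < k.+1) f i * g (k - i)%N.

Fact fps_addA : associative fps_add.
Proof. by move=> f g h; apply/funext => k; rewrite /fps_add addrA. Qed.
Fact fps_addC : commutative fps_add.
Proof. by move=> f g; apply/funext => k; rewrite /fps_add addrC. Qed.
Fact fps_add0 : left_id (fpsC 0) fps_add.
Proof.
by move=> f; apply/funext => k; rewrite /fps_add /fpsC; case: eqP; rewrite add0r.
Qed.
Fact fps_addN : left_inverse (fpsC 0) fps_opp fps_add.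
Proof.
by move=> f; apply/funext => k; rewrite /fps_add /fps_opp /fpsC addNr; case: eqP.
Qed.

HB.instance Definition _ :=
  GRing.isZmodule.Build (fps A) fps_addA fps_addC fps_add0 fps_addN.

Let trunc (N : nat) f : {poly A} := \poly_(i < N) f i.

Let fps_mulE N f g k : (k < N)%N ->
  fps_mul f g k = (trunc N f * trunc N g)`_k.
Proof.
move=> kN; rewrite coefM; apply: eq_bigr => i _.
have iN : (i < N)%N by apply: leq_ltn_trans kN; rewrite -ltnS.
by rewrite !coef_poly iN (leq_ltn_trans (leq_subr _ _) kN).
Qed.

Fact fps_mulC : commutative fps_mul.
Proof.
by move=> f g; apply/funext => k; rewrite !(@fps_mulE k.+1) // mulrC.
Qed.

Fact fps_mulA : associative fps_mul.
Proof.
move=> f g h; apply/funext => k.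
have eqM (p q r : {poly A}) : (forall j, (j <= k)%N -> p`_j = q`_j) ->
    (p * r)`_k = (q * r)`_k.
  by move=> pq; rewrite !coefM; apply: eq_bigr => i _; rewrite pq // -ltnS.
have trM (u v : fps A) j : (j <= k)%N ->
    (trunc k.+1 (fps_mul u v))`_j = (trunc k.+1 u * trunc k.+1 v)`_j.
  by move=> jk; rewrite coef_poly ltnS jk (@fps_mulE k.+1) // ltnS.
rewrite !(@fps_mulE k.+1) // [in LHS]mulrC (eqM _ _ _ (trM g h)).
by rewrite (eqM _ _ _ (trM f g)) mulrC mulrA.
Qed.

Fact fps_mul1 : left_id (fpsC 1) fps_mul.
Proof.
move=> f; apply/funext => k; rewrite /fps_mul big_ord_recl subn0 mul1r big1 ?addr0 //.
by move=> i _; rewrite mul0r.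
Qed.

Fact fps_mulDl : left_distributive fps_mul fps_add.
Proof.
move=> f g h; apply/funext => k; rewrite /fps_add /fps_mul -big_split /=.
by apply: eq_bigr => i _; rewrite mulrDl.
Qed.

Fact fps_1neq0 : fpsC 1 != fpsC 0.
Proof. by apply/eqP => /(congr1 (@^~ 0%N))/eqP; rewrite /fpsC /= oner_eq0. Qed.

HB.instance Definition _ := GRing.Zmodule_isComNzRing.Build (fps A)
  fps_mulA fps_mulC fps_mul1 fps_mulDl fps_1neq0.

End FpsRing.

Section RationalFunctions.
Variable K : fieldType.

Definition ratfun := {fraction {poly K}}.

Definition ratfunC (c : K) : ratfun := FracField.tofrac c%:P.

Definition ratfun_num (f : ratfun) : {poly K} := \n_(generic_quotient.repr f).
Definition ratfun_den (f : ratfun) : {poly K} := \d_(generic_quotient.repr f).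

Definition ratfun_deriv (f : ratfun) : ratfun :=
  let p := ratfun_num f in let q := ratfun_den f in
  FracField.tofrac (p^`() * q - p * q^`()) / FracField.tofrac (q ^+ 2).

(* The chosen fraction need not be reduced: the order is the difference of the
   multiplicities of t0 as a root of the numerator and of the denominator. *)
Definition ratfun_ord (t0 : K) (f : ratfun) : \bar int :=
  if f == 0 then +oo%E
  else (((mup t0 (ratfun_num f))%:Z - (mup t0 (ratfun_den f))%:Z)%:E)%E.

Definition has_pole (f : ratfun) (t0 : K) : Prop := (ratfun_ord t0 f < 0)%E.

End RationalFunctions.

Section PowerLogSeries.
Variable K : fieldType.

(* phi k is the rational function R_k of the series sum_k R_k(ln x) x^k. *)
Definition plseries := fps (ratfun K).

Implicit Types phi u psi : plseries.

Definition delta phi : plseries :=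
  fun k => k%:R * phi k + ratfun_deriv (phi k).

(* The point (x, phi, delta phi, ..., delta^n phi): variable 0 is x, and
   variable lift ord0 j is y_j. *)
Definition jet n phi (i : 'I_n.+2) : plseries :=
  if unlift ord0 i is Some j then iter j delta phi else @fpsX (ratfun K).

Definition eval_jet n (F : {mpoly K[n.+2]}) phi : plseries :=
  mmap (fun c : K => fpsC (ratfunC c)) (@jet n phi) F.

(* The same for coefficients that are rational functions of ln x. *)
Definition eval_jet_log n (M : {mpoly (ratfun K)[n.+2]}) phi : plseries :=
  mmap (@fpsC (ratfun K)) (@jet n phi) M.

Definition starts_with (m : nat) (c : ratfun K) (f : plseries) : Prop :=
  (forall i, (i < m)%N -> f i = 0) /\ f m = c.

Definition L_op n (a : 'I_n.+1 -> ratfun K) (l : nat) u : plseries :=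
  \sum_(j < n.+1) fpsC (a j) * iter j (fun v => delta v + v *+ l) u.

Definition pltrunc (l : nat) phi : plseries :=
  fun k => if (k <= l)%N then phi k else 0.

(* psi = sum_(k >= 1) R_(l + k)(ln x) x^k. *)
Definition pltail (l : nat) phi : plseries :=
  fun k => if k == 0%N then 0 else phi (l + k)%N.

(* L(delta) u = x M(x, ln x, u, ..., delta^n u) is what F(x, y, ..., delta^n y)
   = 0 becomes under y = sum_(k <= l) R_k(ln x) x^k + x^l u after division by
   x^(m + l). *)
Definition reduces_to n (F : {mpoly K[n.+2]}) phi (m l : nat)
    (a : 'I_n.+1 -> ratfun K) (M : {mpoly (ratfun K)[n.+2]}) : Prop :=
  forall u, eval_jet F (pltrunc l phi + @fpsX (ratfun K) ^+ l * u) =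
    @fpsX (ratfun K) ^+ (m + l) *
      (L_op a l u - @fpsX (ratfun K) * eval_jet_log M u).

Definition solves_reduced n (a : 'I_n.+1 -> ratfun K) (l : nat)
    (M : {mpoly (ratfun K)[n.+2]}) u : Prop :=
  L_op a l u = @fpsX (ratfun K) * eval_jet_log M u.

End PowerLogSeries.

(* Main.v *)
Require Import Defs.
From HB Require Import structures.
From mathcomp Require Import all_boot all_order all_algebra.
From mathcomp Require Import complex boolp reals constructive_ereal.
From mathcomp Require Import -(notations) mpoly.
From mathcomp Require Import ring zify.

Set Implicit Arguments.
Unset Strict Implicit.
Unset Printing Implicit Defensive.

Import Order.TTheory GRing.Theory Num.Theory.
Local Open Scope ring_scope.

(* Taylor expansion at the truncation [sum_(k <= l) R_k x^k], carried out in the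
   polynomial ring in [x] and the jet variables, gives [M]: the term of order 0
   vanishes to order [m + l + 1] because the truncation solves [F = 0] up to the
   first-order term, and the term of order 2 does because [2 l >= m + l + 1].

   Comparing the coefficients of [x^k] in the reduced equation expresses
   [sum_j a_j (d/dt + k + l)^j R_k] through [R_1, ..., R_(k-1)].  Fix [t0] and let
   [mu] be the minimum of [ord a_j - j].  If [R_k] has order [z] at [t0], then the
   left-hand side has order [mu + z], unless [z] is a root of an indicial
   polynomial.  That polynomial does not depend on [k], since the summands [k + l]
   only contribute to higher orders.  Hence for a large pole order of [R_k] that
   order is at most [mu] plus the pole order of the right-hand side, and the linear
   bound follows by induction, each monomial of [M] costing a bounded amount.  At a
   point where the [a_j] and the coefficients of [M] are regular and [a_n] does not
   vanish, the same induction runs with all bounds equal to 0. *)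

(** * Orders and leading coefficients of rational functions *)

Section RatfunTheory.
Variable K : fieldType.
Implicit Types (p q : {poly K}) (f g : ratfun K) (t c d : K) (z w : int).

Local Notation "p %:F" := (FracField.tofrac p : ratfun K) (format "p %:F").
Local Notation D := (@ratfun_deriv K).

Lemma ratfun_den_neq0 f : ratfun_den f != 0.
Proof. exact: denom_ratioP. Qed.

Lemma ratfun_numdenE f : f = (ratfun_num f)%:F / (ratfun_den f)%:F.
Proof.
have d0 := ratfun_den_neq0 f.
apply: (canRL (mulfK _)); first by rewrite tofrac_eq0.
rewrite /ratfun_num /ratfun_den -{1}[f]generic_quotient.reprK.
unlock FracField.tofrac; rewrite -[LHS]FracField.pi_mul.
apply/generic_quotient.eqmodP; rewrite /= FracField.equivfE.
by rewrite /FracField.mulf /= !numden_Ratio ?mulf_neq0 ?oner_neq0 // !mulr1 mulrC.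
Qed.

(** [ratfun_deriv] is computed on a chosen fraction; differentiating the cross-multiplied equality
    of two fractions shows that any other fraction gives the same result. *)
Lemma ratfun_deriv_frac p q : q != 0 ->
  D (p%:F / q%:F) = (p^`() * q - p * q^`())%:F / (q ^+ 2)%:F.
Proof.
move=> q0; rewrite /ratfun_deriv.
have := ratfun_numdenE (p%:F / q%:F); have := ratfun_den_neq0 (p%:F / q%:F).
move: (ratfun_num _) (ratfun_den _) => P Q Q0 /eqP.
rewrite eqr_div ?tofrac_eq0 // -!tofracM tofrac_eq => /eqP e.
have /(congr1 (@deriv K)) := e; rewrite !derivM => e'.
apply/eqP; rewrite eqr_div ?tofrac_eq0 ?expf_neq0 // -!tofracM tofrac_eq.
rewrite -subr_eq0; apply/eqP.
(* The difference is a combination of the relation [e] and its derivative [e']. *)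
transitivity (Q * q * ((P^`() * q + P * q^`()) - (p^`() * Q + p * Q^`()))
   - (P * q - p * Q) * (Q^`() * q + Q * q^`())); first by ring.
by rewrite -e' e; ring.
Qed.

Lemma ratfun_derivM f g : D (f * g) = D f * g + f * D g.
Proof.
rewrite (ratfun_numdenE f) (ratfun_numdenE g).
move: (ratfun_den_neq0 f) (ratfun_den_neq0 g).
move: (ratfun_num f) (ratfun_den f) (ratfun_num g) (ratfun_den g) => p q p' q' q0 q'0.
rewrite mulf_div -!tofracM !ratfun_deriv_frac ?mulf_neq0 // !derivM.
(* Polynomials and their derivatives become independent field elements, so that [field] applies. *)
have key (L : fieldType) (a a' b b' c c' d d' : L) : b != 0 -> d != 0 ->
    ((a' * c + a * c') * (b * d) - a * c * (b' * d + b * d')) / (b * d) ^+ 2 =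
    (a' * b - a * b') / b ^+ 2 * (c / d) + a / b * ((c' * d - c * d') / d ^+ 2).
  by move=> b0 d0; field; rewrite b0 d0.
by rewrite !(tofracM, tofracB, tofracD, tofracXn); apply: key; rewrite tofrac_eq0.
Qed.

Lemma ratfun_derivD f g : D (f + g) = D f + D g.
Proof.
rewrite (ratfun_numdenE f) (ratfun_numdenE g).
move: (ratfun_den_neq0 f) (ratfun_den_neq0 g).
move: (ratfun_num f) (ratfun_den f) (ratfun_num g) (ratfun_den g) => p q p' q' q0 q'0.
rewrite addf_div ?tofrac_eq0 // -!tofracM -tofracD !ratfun_deriv_frac ?mulf_neq0 //.
have key (L : fieldType) (a a' b b' c c' d d' : L) : b != 0 -> d != 0 ->
    ((a' * d + a * d' + (c' * b + c * b')) * (b * d)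
       - (a * d + c * b) * (b' * d + b * d')) / (b * d) ^+ 2 =
    (a' * b - a * b') / b ^+ 2 + (c' * d - c * d') / d ^+ 2.
  by move=> b0 d0; field; rewrite b0 d0.
rewrite derivD !derivM !(tofracM, tofracB, tofracD, tofracXn).
by apply: key; rewrite tofrac_eq0.
Qed.

Lemma ratfun_deriv_poly p : D p%:F = (p^`())%:F.
Proof.
rewrite -[in LHS](divr1 p%:F) -tofrac1 ratfun_deriv_frac ?oner_eq0 //.
by rewrite derivC mulr0 subr0 mulr1 expr1n tofrac1 divr1.
Qed.

(** Any fraction with denominator nonzero at [t] may serve as witness, so sums and products need no
    reduction to lowest terms. *)
Definition value_at t f c :=
  exists p q, [/\ q.[t] != 0, f = p%:F / q%:F & c = p.[t] / q.[t]].

Lemma horner_neq0 t q : q.[t] != 0 -> q != 0.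
Proof. by apply: contra_neq => ->; rewrite horner0. Qed.

Lemma value_at_poly t p : value_at t p%:F p.[t].
Proof. by exists p, 1; rewrite hornerE oner_eq0 tofrac1 !divr1. Qed.

Lemma value_at_uniq t f c d : value_at t f c -> value_at t f d -> c = d.
Proof.
move=> [p [q [q0 -> ->]]] [p' [q' [q'0 /eqP + ->]]].
rewrite eqr_div ?tofrac_eq0 ?(horner_neq0 q0) ?(horner_neq0 q'0) //.
rewrite -!tofracM tofrac_eq => /eqP /(congr1 (horner^~ t)).
by rewrite !hornerM => e; apply/eqP; rewrite eqr_div // e.
Qed.

Lemma value_atD t f g c d :
  value_at t f c -> value_at t g d -> value_at t (f + g) (c + d).
Proof.
move=> [p [q [q0 -> ->]]] [p' [q' [q'0 -> ->]]].
exists (p * q' + p' * q), (q * q').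
split; rewrite ?hornerE ?mulf_neq0 //; last by rewrite addf_div.
by rewrite addf_div ?tofrac_eq0 ?(horner_neq0 q0) ?(horner_neq0 q'0) // tofracD !tofracM.
Qed.

Lemma value_atM t f g c d :
  value_at t f c -> value_at t g d -> value_at t (f * g) (c * d).
Proof.
move=> [p [q [q0 -> ->]]] [p' [q' [q'0 -> ->]]].
exists (p * p'), (q * q').
split; rewrite ?hornerM ?mulf_neq0 //; last by rewrite -mulf_div.
by rewrite mulf_div !tofracM.
Qed.

Lemma value_at_deriv t f c : value_at t f c -> exists d, value_at t (D f) d.
Proof.
move=> [p [q [q0 -> _]]]; eexists; exists (p^`() * q - p * q^`()), (q ^+ 2).
by rewrite ratfun_deriv_frac ?(horner_neq0 q0) // horner_exp expf_neq0.
Qed.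

Definition unif t : ratfun K := ('X - t%:P)%:F.

Lemma unif_neq0 t : unif t != 0.
Proof. by rewrite tofrac_eq0 polyXsubC_eq0. Qed.

Lemma ratfun_deriv_unifX t z : D (unif t ^ z) = z%:~R * unif t ^ (z - 1).
Proof.
have u0 := unif_neq0 t.
have nat_case n : D (unif t ^+ n) = n%:R * unif t ^ (n%:Z - 1).
  rewrite -tofracXn ratfun_deriv_poly deriv_exp derivXsubC mul1r.
  (* At exponent 0 the factor [n%:R] kills the spurious power [-1]. *)
  case: n => [|n]; first by rewrite mulr0n tofrac0 mul0r.
  have -> : n.+1%:Z - 1 = n by lia.
  by rewrite tofracMn tofracXn -exprnP mulr_natl.
case: (intP z) => [|n|n]; first exact: (nat_case 0%N).
  exact: nat_case.
(* For negative exponents, differentiate the product of opposite powers, which is 1. *)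
have e : unif t ^ n.+1%:Z * unif t ^ (- n.+1%:Z) = 1 by rewrite -expfzDr // subrr.
move/(congr1 D): e; rewrite ratfun_derivM -tofrac1 ratfun_deriv_poly derivC tofrac0.
rewrite nat_case addrC => /eqP; rewrite addr_eq0 => /eqP e.
apply: (mulfI (expfz_neq0 n.+1%:Z u0)).
rewrite e rmorphN /= mulNr mulrN [unif t ^ n.+1 * _]mulrCA -!mulrA -!expfzDr //.
by rewrite -pmulrn; congr (- (_ * _ ^ _)); lia.
Qed.

(* [f = c (X - t)^z + higher order terms]; [c] may vanish. *)
Definition leading t z f c := value_at t (f * unif t ^ (- z)) c.

Lemma leading_uniq t z f c d : leading t z f c -> leading t z f d -> c = d.
Proof. exact: value_at_uniq. Qed.

Lemma leadingD t z f g c d :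
  leading t z f c -> leading t z g d -> leading t z (f + g) (c + d).
Proof. by rewrite /leading mulrDl; apply: value_atD. Qed.

Lemma leadingM t z w f g c d :
  leading t z f c -> leading t w g d -> leading t (z + w) (f * g) (c * d).
Proof.
rewrite /leading opprD expfzDr ?unif_neq0 // mulrACA; exact: value_atM.
Qed.

Lemma leading_poly t p : leading t 0 p%:F p.[t].
Proof. by rewrite /leading oppr0 expr0z mulr1; apply: value_at_poly. Qed.

Lemma leading_cst t c : leading t 0 (ratfunC c) c.
Proof. by rewrite -{2}(hornerC c t); apply: leading_poly. Qed.

Lemma leading0 t z : leading t z 0 0.
Proof. by have := value_at_poly t 0; rewrite /leading mul0r tofrac0 horner0. Qed.

(** The surplus positive power of ['X - t%:P] vanishes at [t]. *)
Lemma leading_lt t z w f c : (w < z)%R -> leading t z f c -> leading t w f 0.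
Proof.
move=> wz; have -> : w = z + - (`|z - w|%N)%:Z by lia.
have : (0 < `|z - w|)%N by lia.
case: (`|z - w|)%N => // k _ [p [q [q0 e _]]].
exists (('X - t%:P) ^+ k.+1 * p), q; split => //; last first.
  by rewrite hornerM horner_exp hornerXsubC subrr expr0n !mul0r.
rewrite opprD opprK expfzDr ?unif_neq0 // mulrA e tofracM tofracXn.
by rewrite mulrC mulrA.
Qed.

(** Write [f = r * unif t ^ z] with [r] regular at [t]. The term with [D r] keeps a factor [unif t],
    so only the derivative of the power contributes. *)
Lemma leading_deriv t z f c :
  leading t z f c -> leading t (z - 1) (D f) (z%:~R * c).
Proof.
have u0 := unif_neq0 t; rewrite /leading => lf.
have -> : f = f * unif t ^ (- z) * unif t ^ z by rewrite -mulrA -expfzDr // addNr mulr1.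
move: (f * _) lf => {f} r vr.
rewrite ratfun_derivM ratfun_deriv_unifX mulrDl.
have -> : r * (z%:~R * unif t ^ (z - 1)) * unif t ^ (- (z - 1)) = z%:~R * r.
  by rewrite mulrA -mulrA -expfzDr // subrr mulr1 mulrC.
have -> : D r * unif t ^ z * unif t ^ (- (z - 1)) = D r * unif t.
  by rewrite -mulrA -expfzDr // opprB addrC subrK.
have [d vd] := value_at_deriv vr.
rewrite -[_ * c]add0r; apply: value_atD.
  rewrite -(mulr0 d); apply: value_atM => //.
  by have := value_at_poly t ('X - t%:P); rewrite hornerXsubC subrr.
apply: value_atM => //.
have := value_at_poly t (z%:~R)%:P.
by rewrite hornerC !rmorph_int.
Qed.

(** Links the order read off a possibly unreduced fraction to leading coefficients, by splitting the
    powers of ['X - t%:P] off numerator and denominator. *)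
Lemma ratfun_ordP t f : f != 0 ->
  exists z c, [/\ ratfun_ord t f = z%:E%E, c != 0 & leading t z f c].
Proof.
move=> f0; rewrite /ratfun_ord (negbTE f0); move: (ratfun_numdenE f) f0.
move: (ratfun_den_neq0 f).
move: (ratfun_num f) (ratfun_den f) => p q q0 -> f0.
have p0 : p != 0 by apply: contra_neq f0 => ->; rewrite tofrac0 mul0r.
have [i [p1 p1t ep]] := multiplicity_XsubC p t.
have [j [q1 q1t eq]] := multiplicity_XsubC q t.
rewrite p0 q0 /= in p1t q1t; have n0 k := expf_neq0 k (unif_neq0 t).
have -> : mup t p = i.
  by rewrite ep mupMr // mup_XsubCX eqxx.
have -> : mup t q = j.
  by rewrite eq mupMr // mup_XsubCX eqxx.
exists (i%:Z - j%:Z), (p1.[t] / q1.[t]); split => //.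
  by rewrite mulf_neq0 ?invr_neq0.
exists p1, q1; split => //.
rewrite opprB expfzDr ?unif_neq0 // ep eq !tofracM !tofracXn.
rewrite -exprnN -exprnP; move: (n0 i) (n0 j); rewrite /unif => ni nj.
have key (L : fieldType) (x y a b : L) : x != 0 -> y != 0 -> b != 0 ->
    a * x / (b * y) * (y / x) = a / b.
  by move=> x0 y0 b0; field; rewrite x0 y0 b0.
by apply: (key _ _ _ _ _ ni nj); rewrite tofrac_eq0 (horner_neq0 q1t).
Qed.

(** The coefficient may vanish, so cancellation in sums and the zero function need no separate
    treatment. *)
Definition ord_ge t z f := exists c, leading t z f c.

Lemma ord_geW t z w f : (w <= z)%R -> ord_ge t z f -> ord_ge t w f.
Proof.
rewrite le_eqVlt => /orP[/eqP -> //|wz] [c lc]; exists 0; exact: leading_lt wz lc.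
Qed.

Lemma ord_ge_ratfun_ord t z f : ord_ge t z f -> (z%:E <= ratfun_ord t f)%E.
Proof.
move=> [c lf]; have [->|f0] := eqVneq f 0.
  by rewrite /ratfun_ord eqxx leey.
have [w [d [-> d0 lw]]] := ratfun_ordP t f0.
rewrite lee_fin leNgt; apply/negP => wz.
by case/eqP: d0; apply: leading_uniq lw (leading_lt wz lf).
Qed.

Lemma ord_ge0 t z : ord_ge t z 0. Proof. by exists 0; apply: leading0. Qed.

Lemma ord_geD t z f g : ord_ge t z f -> ord_ge t z g -> ord_ge t z (f + g).
Proof. by move=> [c lc] [d ld]; exists (c + d); apply: leadingD. Qed.

Lemma ord_geM t z w f g :
  ord_ge t z f -> ord_ge t w g -> ord_ge t (z + w) (f * g).
Proof. by move=> [c lc] [d ld]; exists (c * d); apply: leadingM. Qed.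

Lemma ord_ge_sum t z (I : Type) (r : seq I) (P : pred I) (F : I -> ratfun K) :
  (forall i, P i -> ord_ge t z (F i)) -> ord_ge t z (\sum_(i <- r | P i) F i).
Proof.
move=> h; apply: big_rec => [|i f Pi]; first exact: ord_ge0.
by apply: ord_geD; apply: h.
Qed.

Lemma leading_nat t n : leading t 0 n%:R n%:R.
Proof.
have -> : n%:R = ratfunC n%:R :> ratfun K by rewrite /ratfunC polyC_natr rmorph_nat.
exact: leading_cst.
Qed.

Lemma ord_ge_deriv t z f : ord_ge t z f -> ord_ge t (z - 1) (D f).
Proof. by move=> [c lc]; exists (z%:~R * c); apply: leading_deriv. Qed.

(** [ord_ge_deriv] would lose one order here; that a regular function loses none keeps the points
    outside [Delta] free of poles. *)
Lemma ord_ge_deriv0 t f : ord_ge t 0 f -> ord_ge t 0 (D f).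
Proof.
rewrite /ord_ge /leading oppr0 expr0z => -[c]; rewrite mulr1 => /value_at_deriv[d vd].
by exists d; rewrite mulr1.
Qed.

End RatfunTheory.
(** * Power series and Taylor expansion *)

Section FpsTheory.
Variable A : comNzRingType.
Implicit Types (f g : fps A) (p : {poly A}).

Local Notation X := (fpsX A).

Lemma fpsDE f g k : (f + g) k = f k + g k. Proof. by []. Qed.
Lemma fpsNE f k : (- f) k = - f k. Proof. by []. Qed.
Lemma fps0E k : (0 : fps A) k = 0.
Proof. by change (fpsC 0 k = 0 :> A); rewrite /fpsC; case: ifP. Qed.
Lemma fpsME f g k : (f * g) k = \sum_(i < k.+1) f i * g (k - i)%N. Proof. by []. Qed.

Lemma fps_sumE (I : Type) (r : seq I) (P : pred I) (F : I -> fps A) k :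
  (\sum_(i <- r | P i) F i) k = \sum_(i <- r | P i) F i k.
Proof.
elim/big_rec2: _ => [|i x y _ <-]; first exact: fps0E.
by rewrite fpsDE.
Qed.

Lemma fps_mulCE c f k : (fpsC c * f) k = c * f k.
Proof.
by rewrite fpsME big_ord_recl subn0 big1 ?addr0 // => i _; rewrite /fpsC mul0r.
Qed.

Lemma fps_mulXE f k : (X * f) k = if k is k'.+1 then f k' else 0.
Proof.
case: k => [|k]; first by rewrite fpsME big_ord1 /fpsX mul0r.
rewrite fpsME !big_ord_recl big1 ?addr0 => [|i _]; last by rewrite /fpsX /= mul0r.
by rewrite /fpsX /= mul0r add0r mul1r subn1.
Qed.

Lemma fps_mulXnE n f k : (X ^+ n * f) k = if (k < n)%N then 0 else f (k - n)%N.
Proof.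
elim: n k => [|n IH] k; first by rewrite mul1r subn0.
by rewrite exprS -mulrA fps_mulXE; case: k => [//|k]; rewrite IH ltnS subSS.
Qed.

Lemma fps_mulXnI n : injective (fun f => X ^+ n * f).
Proof.
move=> f g e; apply/funext => k; move/(congr1 (fun h : fps A => h (k + n)%N)): e.
by rewrite !fps_mulXnE ltnNge leq_addl addnK.
Qed.

Fact fpsC_is_zmod_morphism : zmod_morphism (@fpsC A).
Proof.
move=> c d; apply/funext => k; rewrite fpsDE fpsNE /fpsC.
by case: eqP; rewrite ?subr0.
Qed.

Fact fpsC_is_monoid_morphism : monoid_morphism (@fpsC A).
Proof.
split=> // c d; apply/funext => k; rewrite fps_mulCE /fpsC.
by case: eqP; rewrite ?mulr0.
Qed.

HB.instance Definition _ :=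
  GRing.isZmodMorphism.Build A (fps A) (@fpsC A) fpsC_is_zmod_morphism.
HB.instance Definition _ :=
  GRing.isMonoidMorphism.Build A (fps A) (@fpsC A) fpsC_is_monoid_morphism.

(** Polynomials in [x], unlike series, also map into the polynomial ring in the jet variables, where
    [M] is sought. *)
Definition fps_of_poly p : fps A := fun k => p`_k.

Fact fps_of_poly_is_zmod_morphism : zmod_morphism fps_of_poly.
Proof. by move=> p q; apply/funext => k; rewrite /fps_of_poly coefB. Qed.

Fact fps_of_poly_is_monoid_morphism : monoid_morphism fps_of_poly.
Proof.
split=> [|p q]; apply/funext => k; last by rewrite /fps_of_poly coefM.
change ((1 : {poly A})`_k = fpsC 1 k).
by rewrite coef1 /fpsC; case: (k == 0%N).
Qed.

HB.instance Definition _ := GRing.isZmodMorphism.Build {poly A} (fps A)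
  fps_of_poly fps_of_poly_is_zmod_morphism.
HB.instance Definition _ := GRing.isMonoidMorphism.Build {poly A} (fps A)
  fps_of_poly fps_of_poly_is_monoid_morphism.

Lemma fps_of_polyC c : fps_of_poly c%:P = fpsC c.
Proof. by apply/funext => k; rewrite /fps_of_poly coefC. Qed.

Lemma fps_of_polyX : fps_of_poly 'X = X.
Proof. by apply/funext => k; rewrite /fps_of_poly coefX. Qed.

End FpsTheory.

(** * Second-order Taylor expansion of multivariate polynomials *)

Section MpolyTaylor.
Variables (n : nat) (R : comNzRingType) (S : comNzRingType) (f : {rmorphism R -> S}).
Variables (v w : 'I_n -> S) (c : S).

Let taylor (p : {mpoly R[n]}) := exists r,
  mmap f (fun i => v i + c * w i) p =
  mmap f v p + c * (\sum_i mmap f v (mderiv i p) * w i) + c ^+ 2 * r.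

Let taylorD p q : taylor p -> taylor q -> taylor (p + q).
Proof.
move=> [r er] [s es]; exists (r + s); rewrite !rmorphD /= er es.
under eq_bigr do rewrite mderivD rmorphD mulrDl.
by rewrite big_split /=; ring.
Qed.

Let taylorM p q : taylor p -> taylor q -> taylor (p * q).
Proof.
move=> [r er] [s es]; rewrite /taylor !rmorphM /= er es.
set P := mmap f v p; set Q := mmap f v q.
set P' := \sum_i mmap f v (mderiv i p) * w i.
set Q' := \sum_i mmap f v (mderiv i q) * w i.
have -> : \sum_i mmap f v (mderiv i (p * q)) * w i = P' * Q + P * Q'.
  rewrite mulr_suml mulr_sumr -big_split; apply: eq_bigr => i _ /=.
  by rewrite mderivM rmorphD !rmorphM /= -/P -/Q; ring.
(* All terms of the product of order at least 2 in [c]. *)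
exists (P * s + P' * Q' + c * P' * s + r * Q + c * r * Q' + c ^+ 2 * r * s).
by ring.
Qed.

Let taylorC a : taylor (mpolyC n a).
Proof.
exists 0; rewrite !mmapC big1 ?mulr0 ?addr0 // => i _.
by rewrite mderivC mmap0 mul0r.
Qed.

Let taylorX i : taylor (mpolyX R (mnm1 i)).
Proof.
exists 0; rewrite !mmapX !mmap1U (bigD1 i) //= big1 => [|j ji].
  rewrite mderivX mnm1E eqxx scale1r.
  have -> : mnm_sub (mnm1 i) (mnm1 i) = mnm0.
    by apply/mnmP => j; rewrite mnmBE mnm0E subnn.
  by rewrite mpolyX0 rmorph1 mul1r addr0 mulr0 addr0.
by rewrite mderivX mnm1E eq_sym (negbTE ji) scale0r mmap0 mul0r.
Qed.

(** Constants and variables have such an expansion, and sums and products inherit it. *)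
Lemma mmap_taylor p : taylor p.
Proof.
elim/mpolyind: p => [|a m p _ _]; first by rewrite -(mpolyC0 n R); apply: taylorC.
apply: taylorD; rewrite -mul_mpolyC; apply: taylorM; first exact: taylorC.
rewrite mpolyXE_id; apply: big_ind => [||i _].
- by rewrite -(mpolyC1 n R); apply: taylorC.
- exact: taylorM.
elim: (m i) => [|k IH]; first by rewrite expr0 -(mpolyC1 n R); apply: taylorC.
by rewrite exprS; apply: taylorM => //; apply: taylorX.
Qed.

End MpolyTaylor.

Lemma eq_mmap (n : nat) (R S : nzRingType) (f : R -> S) (v w : 'I_n -> S)
    (p : {mpoly R[n]}) : v =1 w -> mmap f v p = mmap f w p.
Proof.
by move=> vw; apply: eq_bigr => m _; congr (_ * _); apply: eq_bigr => i _; rewrite vw.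
Qed.

Lemma mmap_taylor_lift (n : nat) (R S : comNzRingType) (f : {rmorphism R -> S})
    (v v' : 'I_n.+1 -> S) (u : 'I_n -> S) (c : S) (p : {mpoly R[n.+1]}) :
  v' ord0 = v ord0 -> (forall j, v' (lift ord0 j) = v (lift ord0 j) + c * u j) ->
  exists r, mmap f v' p =
    mmap f v p + c * (\sum_(j < n) mmap f v (mderiv (lift ord0 j) p) * u j) + c ^+ 2 * r.
Proof.
(* The variable [ord0], which stands for [x], is not perturbed. *)
pose w i := if unlift ord0 i is Some j then u j else 0.
move=> v0 vl; have [r er] := mmap_taylor f v w c p; exists r.
have -> : mmap f v' p = mmap f (fun i => v i + c * w i) p.
  apply: eq_mmap => i; rewrite /w.
  by case: (unliftP ord0 i) => [j|] ->; rewrite ?vl // v0 mulr0 addr0.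
rewrite er big_ord_recl /w unlift_none mulr0 add0r.
by under eq_bigr do rewrite liftK.
Qed.

Lemma mmap_comp (n : nat) (R : nzRingType) (S T : comNzRingType) (f : {rmorphism R -> S})
    (g : {rmorphism S -> T}) (v : 'I_n -> S) (p : {mpoly R[n]}) :
  g (mmap f v p) = mmap (g \o f) (g \o v) p.
Proof.
rewrite /mmap rmorph_sum; apply: eq_bigr => m _; rewrite rmorphM; congr (_ * _).
by rewrite /mmap1 rmorph_prod; apply: eq_bigr => i _; rewrite rmorphXn.
Qed.

(** * The operator [delta] and Taylor expansion along jets *)

Section DeltaTheory.
Variable K : fieldType.
Implicit Types (u v phi : plseries K).

Local Notation X := (fpsX (ratfun K)).

HB.instance Definition _ :=
  GRing.RMorphism.copy (@ratfunC K) (@FracField.tofrac {poly K} \o @polyC K).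

Fact ratfun_deriv_is_zmod_morphism : zmod_morphism (@ratfun_deriv K).
Proof.
by move=> f g; have := ratfun_derivD (f - g) g; rewrite subrK => ->; rewrite addrK.
Qed.

HB.instance Definition _ := GRing.isZmodMorphism.Build (ratfun K) (ratfun K)
  (@ratfun_deriv K) ratfun_deriv_is_zmod_morphism.

Fact delta_is_zmod_morphism : zmod_morphism (@delta K).
Proof.
move=> u v; apply/funext => k; rewrite fpsDE fpsNE /delta fpsDE fpsNE raddfB /=.
by ring.
Qed.

HB.instance Definition _ := GRing.isZmodMorphism.Build (plseries K) (plseries K)
  (@delta K) delta_is_zmod_morphism.

(** This is [delta] conjugated by multiplication by [x ^ l]. *)
Definition delta_shift l v := delta v + v *+ l.

Lemma fpsMnE (A : comNzRingType) (f : fps A) m k : (f *+ m) k = f k *+ m.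
Proof. by elim: m => [|m IH]; [rewrite !mulr0n fps0E | rewrite !mulrS fpsDE IH]. Qed.

Lemma delta_mulXn l u : delta (X ^+ l * u) = X ^+ l * delta_shift l u.
Proof.
apply/funext => k; rewrite /delta /delta_shift !fps_mulXnE.
case: ltnP => lk; first by rewrite raddf0 mulr0 addr0.
rewrite fpsDE fpsMnE /delta -{1}(subnK lk) natrD mulrDl -[u _ *+ l]mulr_natl.
by rewrite addrAC.
Qed.

Lemma iter_delta_add_mulXn l j phi u :
  iter j (@delta K) (phi + X ^+ l * u) =
  iter j (@delta K) phi + X ^+ l * iter j (delta_shift l) u.
Proof. by elim: j => [//|j IH]; rewrite !iterS IH raddfD /= delta_mulXn. Qed.

(** Binomial expansion of [(delta + l)^j]. The coefficients are the same for all [u], so the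
    operator is a fixed linear form in the jet variables. *)
Lemma iter_delta_shift l j : exists c : nat -> nat, forall u,
  iter j (delta_shift l) u = \sum_(i < j.+1) iter i (@delta K) u *+ c i.
Proof.
elim: j => [|j [c ec]]; first by exists (fun _ => 1%N) => u; rewrite big_ord1.
(* Pascal's recursion; the guard [i <= j] cuts off the arbitrary values of [c] beyond the previous
   range. *)
exists (fun i => (if i is i'.+1 then c i' else 0)
                 + (if (i <= j)%N then c i * l else 0))%N => u.
rewrite iterS ec /delta_shift raddf_sum /=.
under [RHS]eq_bigr do rewrite mulrnDr.
rewrite [RHS]big_split /=.
rewrite [X in _ = X + _]big_ord_recl [X in _ = _ + X]big_ord_recr /=.
rewrite ltnn !mulr0n add0r addr0.
congr (_ + _); first by apply: eq_bigr => i _; rewrite raddfMn.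
rewrite -sumrMnl; apply: eq_bigr => i _.
by rewrite -ltnS ltn_ord mulrnA.
Qed.

(** [delta] acts on each coefficient separately, so the jet of a truncation consists of polynomials
    in [x]. *)
Lemma iter_delta_eq0 j phi k : phi k = 0 -> iter j (@delta K) phi k = 0.
Proof.
by move=> e; elim: j => [//|j IH]; rewrite iterS {1}/delta IH raddf0 mulr0 addr0.
Qed.

Lemma jet0 n phi : jet phi (ord0 : 'I_n.+2) = X.
Proof. by rewrite /jet unlift_none. Qed.

Lemma jet_lift n phi (j : 'I_n.+1) : jet phi (lift ord0 j) = iter j (@delta K) phi.
Proof. by rewrite /jet liftK. Qed.

Lemma eval_jetE n (F : {mpoly K[n.+2]}) phi :
  eval_jet F phi = mmap (@fpsC (ratfun K) \o @ratfunC K) (@jet K n phi) F.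
Proof. by []. Qed.

Lemma eval_jet_add_mulXn n (F : {mpoly K[n.+2]}) l phi u : exists r,
  eval_jet F (phi + X ^+ l * u) =
  eval_jet F phi
  + X ^+ l * (\sum_(j < n.+1) eval_jet (mderiv (lift ord0 j) F) phi
                              * iter j (delta_shift l) u)
  + X ^+ (l + l) * r.
Proof.
rewrite exprD -expr2; apply: (@mmap_taylor_lift _ _ _ (@fpsC (ratfun K) \o @ratfunC K)).
  by rewrite !jet0.
by move=> j; rewrite !jet_lift iter_delta_add_mulXn.
Qed.

End DeltaTheory.

(** * The reduced equation *)

Lemma fps_mul_eq0 (A : comNzRingType) (f g : fps A) m k :
  (forall i, (i < m)%N -> f i = 0) -> (k < m)%N -> (f * g) k = 0.
Proof.
move=> f0 km; rewrite fpsME big1 // => i _; rewrite f0 ?mul0r //.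
by apply: leq_trans km; rewrite ltnS -ltnS.
Qed.

Lemma poly_divXn (A : nzRingType) N (q : {poly A}) :
  (forall i, (i < N)%N -> q`_i = 0) -> exists s, q = s * 'X^N.
Proof.
move=> q0; exists (drop_poly N q); rewrite -[LHS](poly_take_drop N).
suff -> : take_poly N q = 0 by rewrite add0r.
by apply/polyP => i; rewrite coef_take_poly coef0; case: ifP => // /q0.
Qed.

Lemma eq_poly_rmorphism (A S : nzRingType) (f g : {rmorphism {poly A} -> S}) :
  (forall c, f c%:P = g c%:P) -> f 'X = g 'X -> f =1 g.
Proof.
move=> fgC fgX; elim/poly_ind => [|p c IH]; first by rewrite !rmorph0.
by rewrite !rmorphD !rmorphM IH fgC fgX.
Qed.

(** At the base point [p] is divisible by ['X^(m + l).+1], the partials are [a j] times ['X^m] up to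
    a multiple of ['X^m.+1], and the second-order term carries [2 l] powers of [x]. The rings are
    abstract so that [g] can land in polynomials in the jet variables. *)
Lemma mmap_taylor_factor (n : nat) (R A S : comNzRingType) (f : {rmorphism R -> {poly A}})
    (g : {rmorphism {poly A} -> S}) (v : 'I_n.+1 -> {poly A}) (v' : 'I_n.+1 -> S)
    (T : 'I_n -> S) (a : 'I_n -> A) (m l : nat) (p : {mpoly R[n.+1]}) :
  (m < l)%N ->
  v' ord0 = g (v ord0) ->
  (forall j, v' (lift ord0 j) = g (v (lift ord0 j)) + g 'X ^+ l * T j) ->
  (forall i, (i <= m + l)%N -> (mmap f v p)`_i = 0) ->
  (forall j i, (i < m)%N -> (mmap f v (mderiv (lift ord0 j) p))`_i = 0) ->
  (forall j, (mmap f v (mderiv (lift ord0 j) p))`_m = a j) ->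
  exists M, mmap (g \o f) v' p =
    g 'X ^+ (m + l) * (\sum_j g (a j)%:P * T j - g 'X * M).
Proof.
move=> ml v0 vl p0 dp0 dpa.
have [s es] := poly_divXn (N := (m + l).+1) p0.
have /choice[t et] : forall j : 'I_n, exists t : {poly A},
    mmap f v (mderiv (lift ord0 j) p) = (a j)%:P * 'X^m + t * 'X^(m.+1).
  move=> j; have [i|t et] := poly_divXn (N := m.+1)
      (q := mmap f v (mderiv (lift ord0 j) p) - (a j)%:P * 'X^m).
    rewrite ltnS leq_eqVlt coefB coefCM coefXn => /orP[/eqP->|im].
      by rewrite dpa eqxx mulr1 subrr.
    by rewrite dp0 // (ltn_eqF im) mulr0 subr0.
  by exists t; rewrite -et addrC subrK.
have [r ->] := @mmap_taylor_lift _ _ _ (g \o f) (g \o v) v' T (g 'X ^+ l) p v0 vl.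
have gE G : mmap (g \o f) (g \o v) G = g (mmap f v G) by rewrite mmap_comp.
rewrite gE es rmorphM rmorphXn /=; set x := g 'X.
have -> : \sum_j mmap (g \o f) (g \o v) (mderiv (lift ord0 j) p) * T j =
    x ^+ m * (\sum_j g (a j)%:P * T j + x * \sum_j g (t j) * T j).
  rewrite mulr_sumr -big_split mulr_sumr; apply: eq_bigr => j _ /=.
  by rewrite gE et rmorphD !rmorphM !rmorphXn /= -/x exprS; ring.
(* The remainders of orders 0, 1 and 2, each after extraction of [x ^ (m + l).+1]. *)
exists (- (g s + \sum_j g (t j) * T j + x ^+ (l - m.+1) * r)).
(* Since [m < l], one has [2 l = (m + l) + 1 + (l - m.+1)] without truncated subtraction. *)
have -> : (x ^+ l) ^+ 2 = x ^+ (m + l) * (x * x ^+ (l - m.+1)).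
  by rewrite -exprS -exprM -exprD; congr (_ ^+ _); lia.
by rewrite exprS exprD; ring.
Qed.

(** * Truncation of a solution and construction of [M] *)

Section Reduction.
Variables (K : fieldType) (n : nat) (F : {mpoly K[n.+2]}) (phi : plseries K).
Variables (m l : nat) (a : 'I_n.+1 -> ratfun K).

Local Notation A := (ratfun K).
Local Notation X := (fpsX A).
Local Notation P := {mpoly A[n.+2]}.
Local Notation phi0 := (pltrunc l phi).

Lemma pltrunc_add_pltail : pltrunc l phi + X ^+ l * pltail l phi = phi.
Proof.
apply/funext => k; rewrite fpsDE fps_mulXnE /pltrunc /pltail.
case: (ltngtP k l) => [kl|lk|->]; first by rewrite addr0.
  by rewrite add0r subn_eq0 leqNgt lk /= subnKC // ltnW.
by rewrite subnn addr0.
Qed.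

(** The tail after index [l] is divided by [x ^ l.+1], not by [x ^ l] as in the reduction; the extra
    power gives vanishing at index [m + l] as well in [eval_jet_pltrunc_sol]. *)
Lemma eval_jet_pltrunc (G : {mpoly K[n.+2]}) : exists u r,
  eval_jet G phi =
  eval_jet G phi0
  + X ^+ l.+1 * (\sum_(j < n.+1) eval_jet (mderiv (lift ord0 j) G) phi0 * u j)
  + X ^+ (l.+1 + l.+1) * r.
Proof.
pose u : plseries K := fun k => phi (l + k.+1)%N.
have e : phi = phi0 + X ^+ l.+1 * u.
  apply/funext => k; rewrite fpsDE fps_mulXnE /pltrunc /u ltnS.
  by case: leqP => lk; rewrite ?addr0 // add0r -subSn // subSS subnKC // ltnW.
have [r er] := eval_jet_add_mulXn G l.+1 phi0 u.
by exists (fun j => iter j (delta_shift l.+1) u), r; rewrite -er -e.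
Qed.

Lemma eval_jet_pltruncE (G : {mpoly K[n.+2]}) i :
  (i <= l)%N -> eval_jet G phi0 i = eval_jet G phi i.
Proof.
move=> il; have [u [r ->]] := eval_jet_pltrunc G.
by rewrite !fpsDE !fps_mulXnE ltnS il ltnS (leq_trans il) ?leq_addr // !addr0.
Qed.

Hypothesis phi_sol : eval_jet F phi = 0.
Hypothesis partials : forall j : 'I_n.+1,
  starts_with m (a j) (eval_jet (mderiv (lift ord0 j) F) phi).
Hypothesis lt_ml : (m < l)%N.

(** Up to index [l] the partials at the truncation agree with those at [phi], hence vanish below
    [m]. So the first-order term starts at [m + l.+1] or later, the second-order term at [2 l + 2]
    or later. *)
Lemma eval_jet_pltrunc_sol i : (i <= m + l)%N -> eval_jet F phi0 i = 0.
Proof.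
move=> il; have [u [r e]] := eval_jet_pltrunc F.
have := congr1 (fun f : fps A => f i) (etrans (esym e) phi_sol).
rewrite !fpsDE fps0E !fps_mulXnE.
have -> : (i < l.+1 + l.+1)%N by lia.
rewrite addr0; case: ltnP => li; first by rewrite addr0.
rewrite fps_sumE big1 ?addr0 // => j _; apply: (@fps_mul_eq0 _ _ _ m); last lia.
by move=> k km; rewrite eval_jet_pltruncE ?(partials j).1 //; lia.
Qed.

Let xP : P := mpolyX A (mnm1 ord0).

Let ev u : {rmorphism P -> plseries K} :=
  GRing.RMorphism.clone _ _ (mmap (@fpsC A) (@jet K n u)) _.

Let hx : {rmorphism {poly A} -> P} := GRing.RMorphism.clone _ _ (horner_alg xP) _.

Let bpol (i : 'I_n.+2) : {poly A} :=
  if unlift ord0 i is Some j then \poly_(k < l.+1) iter j (@delta K) phi0 k else 'X.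

Let fps_of_bpol i : fps_of_poly (bpol i) = jet phi0 i.
Proof.
rewrite /bpol /jet; case: unlift => [j|]; last exact: fps_of_polyX.
apply/funext => k; rewrite /fps_of_poly coef_poly ltnS; case: leqP => // lk.
by rewrite iter_delta_eq0 // /pltrunc leqNgt lk.
Qed.

Let f1 : {rmorphism K -> {poly A}} :=
  GRing.RMorphism.clone _ _ (@polyC A \o @ratfunC K) _.

Let q (G : {mpoly K[n.+2]}) := mmap f1 bpol G.

Let fps_of_q G : fps_of_poly (q G) = eval_jet G phi0.
Proof.
rewrite /q (mmap_comp f1 (@fps_of_poly A)) eval_jetE.
have -> : @fps_of_poly A \o f1 = @fpsC A \o @ratfunC K.
  by apply/funext => c; rewrite /= fps_of_polyC.
by apply: eq_mmap => i; rewrite /= fps_of_bpol.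
Qed.

Let ev_x u : ev u xP = X.
Proof. by rewrite /= mmapX mmap1U jet0. Qed.

Let ev_hx u p : ev u (hx p) = fps_of_poly p.
Proof.
apply: (@eq_poly_rmorphism _ _ (ev u \o hx) (@fps_of_poly A)) => [c|].
  by rewrite /= fps_of_polyC horner_algC -[c *: 1]mul_mpolyC mulr1 mmapC.
by rewrite /= fps_of_polyX horner_algX -(ev_x u).
Qed.

Let polys_of_shift : exists T : 'I_n.+1 -> P,
  forall u j, ev u (T j) = iter j (delta_shift l) u.
Proof.
have /choice[T eT] : forall j : 'I_n.+1, exists t, forall u,
    ev u t = iter j (delta_shift l) u.
  move=> j; have [c ec] := iter_delta_shift K l j.
  exists (\sum_(i < j.+1) mpolyX A (mnm1 (lift ord0 (inord i))) *+ c i) => u.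
  rewrite ec raddf_sum; apply: eq_bigr => i _.
  rewrite raddfMn /= mmapX mmap1U jet_lift inordK //.
  by apply: leq_trans (ltn_ord i) _; rewrite ltn_ord.
by exists T => u j; apply: eT.
Qed.

(** The factorisation takes place in [P], where the jet variables stand for an unknown [u];
    evaluation at the jet of each [u] then yields the same [M] for all of them. *)
Lemma reduces_to_exists : exists M, reduces_to F phi m l a M.
Proof.
have [T eT] := polys_of_shift.
(* The jet of the truncation plus [x ^ l] times the unknown, written in [P]. *)
pose v' (i : 'I_n.+2) : P := hx (bpol i)
  + (if unlift ord0 i is Some j then xP ^+ l * T j else 0).
have hxX : hx 'X = xP by rewrite /= horner_algX.
have [|||||M eM] := @mmap_taylor_factor _ _ _ _ f1 hx bpol v' T a m l F lt_ml.
- by rewrite /v' unlift_none addr0.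
- by move=> j; rewrite /v' liftK hxX.
- by move=> i il; have := eval_jet_pltrunc_sol il; rewrite -fps_of_q.
- move=> j i im; rewrite -[_`_i]/(fps_of_poly (q _) i) fps_of_q.
  by rewrite eval_jet_pltruncE ?(partials j).1 // (leq_trans (ltnW im)) // ltnW.
- move=> j; rewrite -[_`_m]/(fps_of_poly (q _) m) fps_of_q.
  by rewrite eval_jet_pltruncE ?(partials j).2 // ltnW.
exists M => u.
have key (S S' : comNzRingType) (e : {rmorphism S -> S'}) x N (b t : 'I_n.+1 -> S) y :
    e (x ^+ N * (\sum_j b j * t j - x * y)) =
    e x ^+ N * (\sum_j e (b j) * e (t j) - e x * e y).
  rewrite rmorphM rmorphXn rmorphB rmorphM rmorph_sum /=.
  by under eq_bigr do rewrite rmorphM.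
have := congr1 (ev u) eM; rewrite key hxX ev_x.
have -> : \sum_j ev u (hx (a j)%:P) * ev u (T j) = L_op a l u.
  by apply: eq_bigr => j _; rewrite ev_hx eT fps_of_polyC.
move=> <-; rewrite (mmap_comp (hx \o f1) (ev u)) eval_jetE.
have -> : ev u \o (hx \o f1) = @fpsC A \o @ratfunC K.
  by apply/funext => c; apply: etrans (ev_hx u (ratfunC c)%:P) (fps_of_polyC _).
apply: eq_mmap => i.
suff -> : (ev u \o v') i = jet phi0 i
    + (if unlift ord0 i is Some j then X ^+ l * iter j (delta_shift l) u else 0).
  case: (unliftP ord0 i) => [j|] ->.
    by rewrite !jet_lift iter_delta_add_mulXn.
  by rewrite !jet0 addr0.
have -> : (ev u \o v') i = ev u (v' i) by [].
rewrite /v' (rmorphD (ev u)) ev_hx fps_of_bpol; congr (_ + _).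
case: unlift => [j|]; last exact: (rmorph0 (ev u)).
by rewrite (rmorphM (ev u)) (rmorphXn (ev u)) ev_x eT.
Qed.

(** Substituting the tail gives back [phi], so the left-hand side is 0 and [x ^ (m + l)] cancels. *)
Lemma reduced_tail M : reduces_to F phi m l a M -> solves_reduced a l M (pltail l phi).
Proof.
move=> red; have := red (pltail l phi); rewrite pltrunc_add_pltail phi_sol.
move=> e; apply/eqP; rewrite -subr_eq0; apply/eqP/(@fps_mulXnI _ (m + l)).
rewrite -e; apply/funext => k; rewrite fps_mulXnE !fps0E.
by case: ifP.
Qed.

End Reduction.

(** * Pole estimates *)

Section LocalEstimate.
Variable K : numFieldType.
Implicit Types (t c : K) (f g : ratfun K) (z mu : int).

Local Notation D := (@ratfun_deriv K).

Lemma leading_sum t z (I : Type) (r : seq I) (F : I -> ratfun K) (c : I -> K) :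
  (forall i, leading t z (F i) (c i)) ->
  leading t z (\sum_(i <- r) F i) (\sum_(i <- r) c i).
Proof.
move=> h; elim/big_rec2: _ => [|i x y _ lxy]; first exact: leading0.
exact: leadingD.
Qed.

Lemma leading_mulrn t z f c s : leading t z f c -> leading t z (f *+ s) (c *+ s).
Proof.
move=> lf; rewrite -mulr_natl -[c *+ s]mulr_natl -[z]add0r.
by apply: leadingM => //; apply: leading_nat.
Qed.

(** The falling factorial [z (z - 1) ... (z - j + 1)] of a possibly negative integer. *)
Definition falling z j : K := \prod_(i < j) (z - i%:Z)%:~R.

(** Each [D] lowers the order by one while [g *+ s] stays one order higher, so the leading
    coefficient comes from [D] alone. *)
Lemma leading_iter_deriv t z f c s j : leading t z f c ->
  leading t (z - j%:Z) (iter j (fun g => D g + g *+ s) f) (falling z j * c).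
Proof.
move=> lf; elim: j => [|j IH]; first by rewrite subr0 /falling big_ord0 mul1r.
have -> : z - j.+1%:Z = z - j%:Z - 1 by lia.
rewrite iterS -[_ * c]addr0; apply: leadingD; last first.
  by apply: leading_lt (leading_mulrn s IH); lia.
rewrite /falling big_ord_recr /= mulrAC mulrC; rewrite /falling in IH.
exact: leading_deriv.
Qed.

(** The indicial polynomial of the operator, evaluated at the exponent [z]. *)
Definition indicial n (alpha : 'I_n.+1 -> K) z := \sum_j alpha j * falling z j.

Lemma leading_operator n (a : 'I_n.+1 -> ratfun K) alpha t mu z f c s :
  (forall j : 'I_n.+1, leading t (mu + j%:Z) (a j) (alpha j)) -> leading t z f c ->
  leading t (mu + z) (\sum_j a j * iter j (fun g => D g + g *+ s) f)
    (indicial alpha z * c).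
Proof.
move=> la lf; rewrite /indicial mulr_suml; apply: leading_sum => j.
have -> : mu + z = mu + j%:Z + (z - j%:Z) by lia.
by rewrite -mulrA; apply: leadingM => //; apply: leading_iter_deriv.
Qed.

(** On the coefficient of [x^k], [delta + l] acts as [D + (k + l)]. *)
Lemma L_opE n (a : 'I_n.+1 -> ratfun K) l (u : plseries K) k :
  L_op a l u k = \sum_j a j * iter j (fun g => D g + g *+ (k + l)) (u k).
Proof.
rewrite /L_op fps_sumE; apply: eq_bigr => j _; rewrite fps_mulCE; congr (_ * _).
elim: (nat_of_ord j) => [//|i IH].
by rewrite !iterS fpsDE fpsMnE {1}/delta IH mulr_natl mulrnDr addrA [_ *+ k + _]addrC.
Qed.

(** [mu] is the minimum of the order of [a j] minus [j] over the nonzero [a j]; a minimiser keeps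
    its true, nonzero leading coefficient. *)
Lemma exists_leading_family n (a : 'I_n.+1 -> ratfun K) t : a ord_max != 0 ->
  exists mu alpha, (forall j : 'I_n.+1, leading t (mu + j%:Z) (a j) (alpha j))
    /\ exists j, alpha j != 0.
Proof.
move=> an0.
have /choice[o eo] : forall j, exists o : int,
    a j != 0 -> exists c, c != 0 /\ leading t o (a j) c.
  move=> j; have [->|/(ratfun_ordP t)[o [c [_ c0 lc]]]] := eqVneq (a j) 0.
    by exists 0.
  by exists o => _; exists c.
case: (@arg_minP _ _ _ ord_max (fun j => a j != 0) (fun j : 'I_n.+1 => o j - j%:Z) an0)
  => j0 aj0 min_j0.
exists (o j0 - j0%:Z).
have /choice[alpha la] : forall j : 'I_n.+1, exists c,
    leading t (o j0 - j0%:Z + j%:Z) (a j) c.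
  move=> j; have [->|aj] := eqVneq (a j) 0; first by exists 0; apply: leading0.
  have [c [_ lc]] := eo j aj.
  apply: (@ord_geW _ _ (o j)); last by exists c.
  by have := min_j0 j aj; lia.
exists alpha; split=> //; exists j0.
have [c [c0 lc]] := eo j0 aj0; have := la j0; rewrite subrK => l0.
by rewrite (leading_uniq l0 lc).
Qed.

End LocalEstimate.

(** * Indicial roots and exceptional points *)

Section IndicialRoots.
Variable K : numClosedFieldType.

Lemma poly_roots_finite (p : {poly K}) : p != 0 ->
  exists s : seq K, forall t, root p t -> t \in s.
Proof.
move=> p0; have [s e] := closed_field_poly_normal p; exists s => t.
by rewrite e rootZ ?lead_coef_eq0 // root_prod_XsubC.
Qed.

Lemma indicial_neq0_large n (alpha : 'I_n.+1 -> K) : (exists j, alpha j != 0) ->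
  exists N : nat, forall p : nat, (N < p)%N -> indicial alpha (- p%:Z) != 0.
Proof.
move=> [j1 aj1]; pose Q := \sum_j alpha j *: \prod_(i < j) ('X - (i%:R : K)%:P).
have QE z : Q.[z%:~R] = indicial alpha z.
  rewrite horner_sum; apply: eq_bigr => j _; rewrite hornerZ horner_prod; congr (_ * _).
  by apply: eq_bigr => i _; rewrite hornerXsubC rmorphB /= -pmulrn.
(* Evaluate at the least index [j0] with nonzero [alpha j0]: terms with larger [j] contain the
   factor [j0 - j0], so only [alpha j0] times [j0!] is left. *)
have Q0 : Q != 0.
  case: (@arg_minnP _ j1 (fun j => alpha j != 0) (@nat_of_ord n.+1) aj1) => j0 aj0 min_j0.
  apply: contra_neq aj0 => Q0; have := QE j0; rewrite Q0 horner0 => /esym/eqP.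
  rewrite /indicial (bigD1 j0) //= big1 => [|j jj0]; last first.
    have [->|/min_j0 le_j] := eqVneq (alpha j) 0; first by rewrite mul0r.
    have lt_j : (j0 < j)%N by rewrite ltn_neqAle le_j andbT eq_sym.
    by rewrite /falling (bigD1 (Ordinal lt_j)) //= subrr mul0r mulr0.
  rewrite addr0 mulf_eq0 => /orP[/eqP//|/prodf_eq0[i _]].
  by rewrite intr_eq0 subr_eq0 eqz_nat gtn_eqF.
have [s hs] := poly_roots_finite Q0.
(* Each root equals [- p] for at most one natural [p]. *)
have [N hN] : exists N : nat, forall p : nat, (N < p)%N -> (- p%:Z)%:~R \notin s.
  elim: s {hs} => [|x s [N hN]]; first by exists 0%N.
  have [[p0 ep0]|no] := pselect (exists p0 : nat, (- p0%:Z)%:~R = x).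
    exists (maxn N p0) => p; rewrite gtn_max => /andP[/hN Np p0p].
    rewrite in_cons negb_or Np andbT -ep0 eqr_int eqr_opp eqz_nat.
    by rewrite gtn_eqF.
  exists N => p /hN Np; rewrite in_cons negb_or Np andbT.
  by apply/eqP => e; apply: no; exists p.
exists N => p /hN; apply: contra => e; apply: hs.
by rewrite /root QE.
Qed.

Lemma ratfun_unit_cofinite (f : ratfun K) : f != 0 ->
  exists s : seq K, forall t, t \notin s -> exists c, c != 0 /\ leading t 0 f c.
Proof.
move: (ratfun_numdenE f) (ratfun_den_neq0 f).
move: (ratfun_num f) (ratfun_den f) => p q -> q0 f0.
have p0 : p != 0 by apply: contra_neq f0 => ->; rewrite tofrac0 mul0r.
have [s hs] := poly_roots_finite p0; have [s' hs'] := poly_roots_finite q0.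
exists (s ++ s') => t; rewrite mem_cat negb_or => /andP[ts ts'].
have pt : p.[t] != 0 by apply: contra ts => /hs.
have qt : q.[t] != 0 by apply: contra ts' => /hs'.
exists (p.[t] / q.[t]); split; first by rewrite mulf_neq0 ?invr_neq0.
by exists p, q; rewrite oppr0 expr0z mulr1.
Qed.

Lemma ratfun_regular_cofinite (f : ratfun K) :
  exists s : seq K, forall t, t \notin s -> ord_ge t 0 f.
Proof.
have [->|/ratfun_unit_cofinite[s hs]] := eqVneq f 0.
  by exists [::] => t _; apply: ord_ge0.
by exists s => t /hs[c [_ lc]]; exists c.
Qed.

End IndicialRoots.

(** * Pole orders of products and polynomials of series *)

Section SeriesBound.
Variables (K : fieldType) (t : K) (C k : nat).
Implicit Types (f g : plseries K) (N : nat).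

(** The slope [C] is shared, while the offset [N] adds up in products. Only indices below [k] occur,
    as these are what the induction knows. *)
Definition linear_pole_bound N f :=
  forall i, (i < k)%N -> ord_ge t (- (N + i * C)%:Z) (f i).

Lemma linear_pole_bound_le N N' f :
  (N <= N')%N -> linear_pole_bound N f -> linear_pole_bound N' f.
Proof. by move=> NN' hf i /hf; apply: ord_geW; rewrite lerN2 lez_nat leq_add2r. Qed.

Lemma linear_pole_bound_sum N (I : eqType) (r : seq I) (F : I -> plseries K) :
  (forall i, i \in r -> linear_pole_bound N (F i)) ->
  linear_pole_bound N (\sum_(i <- r) F i).
Proof.
move=> h i ik; rewrite fps_sumE big_seq_cond; apply: ord_ge_sum => j.
by rewrite andbT => /h; apply.
Qed.

Lemma linear_pole_boundM N N' f g : linear_pole_bound N f -> linear_pole_bound N' g ->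
  linear_pole_bound (N + N') (f * g).
Proof.
move=> hf hg i ik; rewrite fpsME; apply: ord_ge_sum => j _.
have ji : (j <= i)%N by rewrite -ltnS.
have -> : - (N + N' + i * C)%:Z = - (N + j * C)%:Z + - (N' + (i - j) * C)%:Z.
  rewrite -opprD -PoszD; congr (- Posz _).
  by rewrite addnACA -mulnDl subnKC.
apply: ord_geM; first by apply: hf; apply: leq_ltn_trans ik.
by apply: hg; apply: leq_ltn_trans ik; apply: leq_subr.
Qed.

Lemma linear_pole_boundC N c : ord_ge t (- N%:Z) c -> linear_pole_bound N (fpsC c).
Proof.
move=> hc [|i] _; first by rewrite mul0n addn0.
exact: ord_ge0.
Qed.

Lemma ord_ge1 : ord_ge t 0 (1 : ratfun K).
Proof. by exists 1; apply: (leading_nat t 1). Qed.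

Lemma linear_pole_bound1 : linear_pole_bound 0 1.
Proof. by apply: linear_pole_boundC; apply: ord_ge1. Qed.

Lemma linear_pole_boundX : linear_pole_bound 0 (fpsX (ratfun K)).
Proof.
move=> i _; rewrite /fpsX; case: eqP => _; last exact: ord_ge0.
by apply: ord_geW ord_ge1; lia.
Qed.

Lemma linear_pole_bound_mmap1 p e (v : 'I_p -> plseries K) (m : multinom p) :
  (forall i, linear_pole_bound e (v i)) -> linear_pole_bound (e * mdeg m) (mmap1 v m).
Proof.
move=> hv; rewrite /mmap1 mdegE big_distrr /=.
elim/big_rec2: _ => [|i x y _ IH]; first exact: linear_pole_bound1.
apply: linear_pole_boundM => //; elim: (m i) => [|q IHq].
  by rewrite muln0; apply: linear_pole_bound1.
by rewrite exprS mulnS; apply: linear_pole_boundM.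
Qed.

(** A monomial of [M] has degree below [msize M], and each factor adds at most [e] to the offset;
    the slope is unchanged. *)
Lemma linear_pole_bound_mmap p e N (v : 'I_p -> plseries K) (M : {mpoly (ratfun K)[p]}) :
  (forall m, m \in msupp M -> ord_ge t (- N%:Z) (mcoeff m M)) ->
  (forall i, linear_pole_bound e (v i)) ->
  linear_pole_bound (N + e * msize M) (mmap (@fpsC (ratfun K)) v M).
Proof.
move=> hM hv; apply: linear_pole_bound_sum => m mM.
apply: linear_pole_boundM; first exact/linear_pole_boundC/hM.
apply: linear_pole_bound_le (linear_pole_bound_mmap1 m hv).
by rewrite leq_mul2l (ltnW (msize_mdeg_lt mM)) orbT.
Qed.

End SeriesBound.

(** * Inductive pole bound for solutions of the reduced equation *)

Section SolutionBound.
Variables (K : numFieldType) (n l : nat) (a : 'I_n.+1 -> ratfun K).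
Variables (M : {mpoly (ratfun K)[n.+2]}).

(* [e] bounds the order lost under [delta^j], [j <= n]: it is [n] at a general
   point, and 0 where all coefficients of [psi] are regular. *)
Lemma ord_ge_solution t mu alpha (N e C : nat) psi :
  (forall j : 'I_n.+1, leading t (mu + j%:Z) (a j) (alpha j)) ->
  (forall p : nat, (C < p)%N -> indicial alpha (- p%:Z) != 0) ->
  (forall m, m \in msupp M -> ord_ge t (- N%:Z) (mcoeff m M)) ->
  (forall i j, (j < n.+1)%N -> ord_ge t (- (i * C)%:Z) (psi i) ->
     ord_ge t (- (e + i * C)%:Z) (iter j (@delta K) psi i)) ->
  (mu + (N + e * msize M)%:Z <= C%:Z) ->
  psi 0%N = 0 -> solves_reduced a l M psi ->
  forall k, ord_ge t (- (k * C)%:Z) (psi k).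
Proof.
move=> la alpha_neq0 hM hdelta hC psi0 sol; elim/ltn_ind => -[|k] IH.
  by rewrite psi0; apply: ord_ge0.
have bnd : linear_pole_bound t C k.+1 (N + e * msize M) (eval_jet_log M psi).
  apply: linear_pole_bound_mmap => // i; case: (unliftP ord0 i) => [j|] ->.
    by rewrite jet_lift => i' ik; apply: hdelta => //; apply: IH.
  by rewrite jet0; apply: linear_pole_bound_le (@linear_pole_boundX _ _ _ _).
(* The factor [x] pairs coefficient [k.+1] on the left with coefficient [k] of the evaluated [M];
   this gap of one index leaves room for [C]. *)
have := congr1 (fun f : plseries K => f k.+1) sol; rewrite /= fps_mulXE L_opE => eq_k.
have [c' lc'] := bnd k (ltnSn k); rewrite -eq_k in lc'.
have [->|psik] := eqVneq (psi k.+1) 0; first exact: ord_ge0.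
have [z [c [_ c0 lz]]] := ratfun_ordP t psik.
have [zk|zk] := lerP (- (k.+1 * C)%:Z) z; first by apply: ord_geW zk _; exists c.
have lL := leading_operator (k.+1 + l) la lz.
have [p ep] : exists p : nat, z = - p%:Z by exists `|z|%N; lia.
have Cp : (C < p)%N by move: zk; rewrite ep mulSn; lia.
(* The left-hand side has order exactly [mu + z], which lies below the order guaranteed by [lc']
   because [mu - C <= - (N + e * msize M)]. *)
have /negP[] : indicial alpha z * c != 0 by rewrite mulf_neq0 // ep alpha_neq0.
apply/eqP; apply: leading_uniq lL (leading_lt _ lc').
by move: zk; rewrite mulSn; lia.
Qed.

Lemma iter_deltaE (psi : plseries K) i j :
  iter j (@delta K) psi i = iter j (fun g => i%:R * g + ratfun_deriv g) (psi i).
Proof. by elim: j => [//|j IH]; rewrite !iterS {1}/delta IH. Qed.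

Lemma ord_ge_iter_delta t z (psi : plseries K) i j :
  ord_ge t z (psi i) -> ord_ge t (z - j%:Z) (iter j (@delta K) psi i).
Proof.
rewrite iter_deltaE => hz; elim: j => [|j IH]; first by rewrite subr0.
rewrite iterS; have -> : z - j.+1%:Z = z - j%:Z - 1 by lia.
apply: ord_geD; last exact: ord_ge_deriv.
apply: (@ord_geW _ _ (0 + (z - j%:Z))); first by lia.
by apply: ord_geM => //; exists i%:R; apply: leading_nat.
Qed.

Lemma ord_ge0_iter_delta t (psi : plseries K) i j :
  ord_ge t 0 (psi i) -> ord_ge t 0 (iter j (@delta K) psi i).
Proof.
rewrite iter_deltaE => h0; elim: j => [//|j IH].
rewrite iterS; apply: ord_geD; last exact: ord_ge_deriv0.
by rewrite -[0]addr0; apply: ord_geM => //; exists i%:R; apply: leading_nat.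
Qed.

End SolutionBound.

Lemma seq_uniform_bound (T : eqType) (s : seq T) (P : T -> nat -> Prop) :
  (forall x N N', (N <= N')%N -> P x N -> P x N') -> (forall x, exists N, P x N) ->
  exists N, forall x, x \in s -> P x N.
Proof.
move=> P_le exP; elim: s => [|x s [N hN]]; first by exists 0%N.
have [N' hN'] := exP x; exists (maxn N N') => y; rewrite in_cons => /orP[/eqP->|/hN].
  by apply: P_le hN'; apply: leq_maxr.
by apply: P_le; apply: leq_maxl.
Qed.

Lemma ord_ge_exists (K : fieldType) (t : K) (f : ratfun K) :
  exists N : nat, ord_ge t (- N%:Z) f.
Proof.
have [->|/(ratfun_ordP t)[z [c [_ _ lc]]]] := eqVneq f 0.
  by exists 0%N; apply: ord_ge0.
by exists `|z|%N; apply: (@ord_geW _ _ z); [lia|exists c].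
Qed.

(** * Constants uniform over all solutions *)

Section GlobalEstimate.
Variables (K : numClosedFieldType) (n l : nat) (a : 'I_n.+1 -> ratfun K).
Variables (M : {mpoly (ratfun K)[n.+2]}).
Hypothesis an_neq0 : a ord_max != 0.

Let solution psi := psi 0%N = 0 /\ solves_reduced a l M psi.

Lemma linear_bound_exists t : exists C : nat, forall psi, solution psi ->
  forall k, ord_ge t (- (k * C)%:Z) (psi k).
Proof.
have [mu [alpha [la alpha0]]] := exists_leading_family t an_neq0.
have [N1 hN1] := indicial_neq0_large alpha0.
have [N hN] := @seq_uniform_bound _ (msupp M)
  (fun m N => ord_ge t (- N%:Z) (mcoeff m M))
  (fun m N N' NN' => ord_geW (t := t) (f := mcoeff m M) (ltac:(lia) : - N'%:Z <= - N%:Z))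
  (fun m => ord_ge_exists t (mcoeff m M)).
(* [N1] stays clear of the indicial roots; the rest absorbs [mu], the poles of the coefficients of
   [M] and up to [n] derivatives per factor of a monomial. *)
exists (N1 + (`|mu| + (N + n * msize M)))%N => psi [psi0 sol].
apply: (@ord_ge_solution _ _ _ _ _ _ _ _ N n _ _ la _ hN _ _ psi0 sol).
- by move=> p ltp; apply: hN1; lia.
- move=> i j jn hi; apply: ord_geW (ord_ge_iter_delta j hi).
  by rewrite PoszD; lia.
- by rewrite addnA [in leRHS]PoszD lerD2r; lia.
Qed.

Lemma regular_cofinite : exists Delta : seq K, forall t, t \notin Delta ->
  forall psi, solution psi -> forall k, ord_ge t 0 (psi k).
Proof.
have family (r : seq (ratfun K)) : exists s : seq K, forall t, t \notin s ->
    forall f, f \in r -> ord_ge t 0 f.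
  elim: r => [|g r [s hs]]; first by exists [::].
  have [s' hs'] := ratfun_regular_cofinite g; exists (s' ++ s) => t.
  rewrite mem_cat negb_or => /andP[/hs' tg /hs tr] f.
  by rewrite in_cons => /orP[/eqP->|/tr].
have [s1 hs1] := ratfun_unit_cofinite an_neq0.
have [s2 hs2] :=
  family ([seq a j | j <- enum 'I_n.+1] ++ [seq mcoeff m M | m <- msupp M]).
exists (s1 ++ s2) => t; rewrite mem_cat negb_or => /andP[/hs1[c [c0 lc]] /hs2 reg].
move=> psi [psi0 sol] k.
have -> : 0 = - (k * 0)%:Z by rewrite muln0.
(* With [mu = - n] the order [mu + j] is negative for [j < n], where a regular [a j] has coefficient
   0; only [a ord_max] contributes. *)
pose alpha (j : 'I_n.+1) := if j == ord_max then c else 0.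
apply: (@ord_ge_solution _ _ _ a M t (- n%:Z) alpha 0 0) psi0 sol _
  => [j|p p0|m mM|i j _|].
- rewrite /alpha; case: eqP => [->|/eqP jn]; first by rewrite addNr.
  have [d ld] : ord_ge t 0 (a j).
    by apply: reg; rewrite mem_cat map_f // mem_enum.
  apply: leading_lt ld.
  have : (j < n)%N by rewrite ltn_neqAle -ltnS ltn_ord andbT -val_eqE in jn *.
  by lia.
(* What remains is [c] times a falling factorial, whose roots are nonnegative, while [- p] is
   negative. *)
- rewrite /indicial (bigD1 ord_max) //= big1 => [|j jn]; last first.
    by rewrite /alpha (negbTE jn) mul0r.
  rewrite addr0 /alpha eqxx mulf_neq0 //; apply/prodf_neq0 => i _.
  by rewrite intr_eq0; lia.
- by apply: reg; rewrite mem_cat (map_f (fun m => mcoeff m M) mM) orbT.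
- by rewrite muln0; apply: ord_ge0_iter_delta.
- by lia.
Qed.

End GlobalEstimate.

Theorem lemma2 (R : realType) (n : nat) (F : {mpoly R[i][n.+2]})
    (phi : plseries R[i]) (m l : nat) (a : 'I_n.+1 -> ratfun R[i])
    (phi_sol : eval_jet F phi = 0)
    (partials : forall j : 'I_n.+1,
      starts_with m (a j) (eval_jet (mderiv (lift ord0 j) F) phi))
    (an_neq0 : a ord_max != 0)
    (lt_ml : (m < l)%N) :
  exists M : {mpoly (ratfun R[i])[n.+2]},
    [/\ reduces_to F phi m l a M,
        solves_reduced a l M (pltail l phi) &
        (* Delta and C depend on the reduced equation only: they serve all of
           its solutions psi of this form, among them the tail of phi. *)
        exists (Delta : seq R[i]) (C : R), 0 < C /\
          forall psi : plseries R[i], psi 0%N = 0 -> solves_reduced a l M psi ->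
          forall k : nat, (1 <= k)%N ->
            (forall t0 : R[i], has_pole (psi k) t0 -> t0 \in Delta) /\
            (forall t0 : R[i], t0 \in Delta ->
               (- er_map intr (ratfun_ord t0 (psi k)) <= (k%:R * C)%:E)%E)].
Proof.
have [M red] := reduces_to_exists phi_sol partials lt_ml.
exists M; split => //; first exact: reduced_tail red.
have [Delta regular] := @regular_cofinite _ _ l _ M an_neq0.
have [N bnd] := @seq_uniform_bound _ Delta
  (fun t N => forall psi, psi 0%N = 0 /\ solves_reduced a l M psi ->
     forall k, ord_ge t (- (k * N)%:Z) (psi k))
  (fun t N N' NN' h psi sol k => ord_geW
     (ltac:(by rewrite lerN2 lez_nat leq_mul2l NN' orbT) : - (k * N')%:Z <= - (k * N)%:Z)
     (h psi sol k))
  (linear_bound_exists l M an_neq0).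
(* The successor makes the constant positive even when [N = 0]. *)
exists Delta, N.+1%:R; split; first by rewrite ltr0n.
move=> psi psi0 sol k _; split => t0.
  rewrite /has_pole => pole; apply/negPn/negP => /regular reg.
  have := ord_ge_ratfun_ord (reg psi (conj psi0 sol) k).
  by rewrite leNgt pole.
move=> /bnd /(_ psi (conj psi0 sol) k) /ord_ge_ratfun_ord.
(* Order [+oo], that of the zero function, becomes [-oo] under the sign; order [-oo] contradicts the
   lower bound. *)
case: (ratfun_ord t0 (psi k)) => [w| |//] /=; last by rewrite leNye.
rewrite !lee_fin => hw; rewrite -natrM -rmorphN /= pmulrn ler_int.
by move: hw; rewrite mulnS PoszD; lia.
Qed.
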